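(* If $f\in C^6[0,1]$ and $x\in[0,1]$, then for sufficiently large $n$ we have $$\tilde D_n^{M,2}(f;x)-f(x)=\mathcal{O}\left(\frac{1}{n^2}\right).$$
   Context: For integers $n\ge 0$ and $k$, $p_{n,k}(x)=\binom{n}{k}x^k(1-x)^{n-k}$ for $0\le k\le n$, and $p_{n,k}(x)=0$ if $k<0$ or $k>n$. For $n\ge 2$ and $x\in[0,1]$ the operator $\tilde D_n^{M,2}$ is $$\tilde D_n^{M,2}(f;x)=(n+1)\sum_{k=0}^n\tilde p_{n,k}^{M,2}(x)\int_0^1 p_{n,k}(t)f(t)\,dt,$$ where $$\tilde p_{n,k}^{M,2}(x)=\left((n-2)x^2-nx+\tfrac32\right)p_{n-2,k}(x)+2(n-2)x(1-x)\,p_{n-2,k-1}(x)+\left((n-2)x^2-(n-4)x-\tfrac12\right)p_{n-2,k-2}(x).$$ *)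

(* Defs.v *)
From HB Require Import structures.
From mathcomp Require Import all_boot all_order all_algebra.
From mathcomp Require Import all_classical all_reals all_analysis.
Set Implicit Arguments.
Unset Strict Implicit.
Unset Printing Implicit Defensive.
Import Order.TTheory GRing.Theory Num.Theory numFieldNormedType.Exports.
Local Open Scope classical_set_scope.
Local Open Scope ring_scope.

(* Derivatives relative to A: two-sided at interior points of an interval,
   one-sided at its endpoints; the values of f outside A are irrelevant. *)
Definition has_derivative_within {R : realType} (A : set R) (f f' : R -> R) :=
  forall x, A x ->
    (fun y => (f y - f x) / (y - x)) @ within A x^' --> f' x.

(* The class C^k(A), for A an interval that is not a singleton. *)
Fixpoint Ck_within {R : realType} (A : set R) (k : nat) (f : R -> R) : Prop :=
  match k with
  | 0%N => {within A, continuous f}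
  | k'.+1 => exists2 f' : R -> R, has_derivative_within A f f' &
                                  Ck_within A k' f'
  end.

(* 'C(n, j) = 0 for j > n, which covers the convention p_{n,k} = 0 for k > n. *)
Definition bernstein {R : realType} (n : nat) (k : int) (x : R) : R :=
  match k with
  | Posz j => 'C(n, j)%:R * x ^+ j * (1 - x) ^+ (n - j)
  | Negz _ => 0
  end.

(* Meaningful for 2 <= n only, because of the truncated subtraction n - 2 in
   the degree. *)
Definition ptilde {R : realType} (n : nat) (k : int) (x : R) : R :=
  ((n%:R - 2) * x ^+ 2 - n%:R * x + 3 / 2) * bernstein (n - 2)%N k x
  + 2 * (n%:R - 2) * x * (1 - x) * bernstein (n - 2)%N (k - 1) x
  + ((n%:R - 2) * x ^+ 2 - (n%:R - 4) * x - 1 / 2) * bernstein (n - 2)%N (k - 2) x.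

Definition Dtilde {R : realType} (n : nat) (f : R -> R) (x : R) : R :=
  (n%:R + 1) * \sum_(k < n.+1) (ptilde n k%:Z x *
     \int[lebesgue_measure]_(t in `[0, 1]) (bernstein n k%:Z t * f t)).

(* Main.v *)
From HB Require Import structures.
Require Import Defs.
From mathcomp Require Import all_boot all_order all_algebra.
From mathcomp Require Import all_classical all_reals all_analysis.
From mathcomp Require Import ring lra.
Import Order.TTheory GRing.Theory Num.Theory numFieldNormedType.Exports.
Local Open Scope classical_set_scope.
Local Open Scope ring_scope.
Set Implicit Arguments.
Unset Strict Implicit.
Unset Printing Implicit Defensive.

(** Write P = x (1 - x), n = m + 2, and let U_{s,i} be the positive operator
    that sends f to the sum over k of p_{m,k}(x) times the average of f
    against the probability density (m + s + 1) p_{m+s,k+i} on [0,1].  The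
    weights of the operator D under study are chosen so that

      D = (3/2 - 2x) U_{2,0} + (2x - 1/2) U_{2,2}
          - m P (U_{2,2} - 2 U_{2,1} + U_{2,0}).

    The coefficient of the last term grows with n, but the second difference
    in i is harmless on polynomials: the derivative of p_{n+1,k+1} is
    (n + 1) (p_{n,k} - p_{n,k+1}), so an integration by parts turns a
    difference in i into a derivative of the argument divided by m + s + 2
    ([durrmeyer_poly_diff]).  Hence on a polynomial q the last term is
    -m P / ((n + 2) (n + 3)) U_{4,2}(q'') ([Dtilde_poly_deriv2]).

    Central moments of the U_{s,i} satisfy a three-term recurrence
    ([durrmeyer_poly_moment_rec]), obtained from an integration by parts in t
    and from the identity for the sum of p_{m,k}(x) (k - m x) g(k); the latter
    again produces a difference in k, that is, a derivative and a gain of a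
    factor 1/n.  By induction U_{s,i}((t-x)^j) is O(n^-ceil(j/2))
    ([durrmeyer_poly_moment_bound]).  Consequently D((t-x)^j) is O(n^-2) for
    j >= 3 without any cancellation; for j = 0, 1, 2 the moment is exactly
    1, 0 and (20 P - 3) / ((n + 2) (n + 3)).  This settles all polynomials
    ([Dtilde_poly_bound]).

    A function of class C^6 differs from a polynomial in t - x by at most
    C |t-x|^6 ([Ck_within_taylor]).  On this remainder no cancellation between
    the three U_{2,i} is used: each is positive, their coefficients are O(n),
    and the sixth central moment is O(n^-3), so that the remainder contributes
    O(n^-2) ([Dtilde_remainder_bound]).  This is where six derivatives are
    spent. *)

(** * Taylor expansion for one-sided derivatives *)

Lemma has_derivative_within_continuous (R : realType) (A : set R)
    (f f' : R -> R) :
  has_derivative_within A f f' -> {within A, continuous f}.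
Proof.
move=> df; apply/subspace_continuousP => x Ax.
(* f as its value at x plus slope times increment, valid for y != x *)
have quot : (fun y => f x + (f y - f x) / (y - x) * (y - x)) @ within A x^'
    --> f x.
  rewrite -[X in _ --> X]addr0 -[X in _ --> _ + X](mulr0 (f' x)).
  apply: cvgD; first exact: cvg_cst.
  apply: cvgM; first exact: df.
  apply/subr_cvg0; apply: cvg_within_filter; apply: cvg_within_filter.
  exact: cvg_id.
apply/cvgrPdist_lt => e e0; move/cvgrPdist_lt/(_ e e0): quot.
rewrite !near_withinE => H; near=> y => Ay.
have [->|yx] := eqVneq y x; first by rewrite subrr normr0.
rewrite -[X in _ - X](subrK (f x)) -[X in _ - (X + _)](@divfK _ (y - x)).
  by rewrite [X in _ - X]addrC; apply: (near H y).
by rewrite subr_eq0.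
Unshelve. all: by end_near. Qed.

Lemma has_derivative_within_is_derive (R : realType) (A : set R)
    (f f' : R -> R) (x : R) :
  has_derivative_within A f f' -> A^° x -> is_derive x 1 f (f' x).
Proof.
move=> df Ax.
have quot : (fun h => h^-1 *: ((f \o shift x) (h *: 1) - f x)) @ 0^' --> f' x.
  apply/cvgrPdist_lt => e e0.
  have /cvgrPdist_lt/(_ e e0) := df x (nbhs_singleton Ax).
  rewrite !near_withinE => H.
  have {}H : \forall y \near x, y != x ->
      `|f' x - (f y - f x) / (y - x)| < e.
    by near=> y => yx; apply: (near H y) => //; exact: (near Ax y).
  move/nbhs0P: H => H; near=> h => /= h0.
  have : `|f' x - (f (x + h) - f x) / (x + h - x)| < e.
    apply: (near H h) => //.
    by rewrite -subr_eq0 addrAC subrr add0r.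
  by rewrite /= -[h *: 1]/(h * 1) mulr1 addrAC subrr add0r [h + x]addrC mulrC.
by apply: DeriveDef; [exact: cvgP quot|exact: cvg_lim quot].
Unshelve. all: by end_near. Qed.

(** Mean value inequality centred at x.  The comparison function h is
    differentiable on the whole line, which lets the mean value theorem apply
    to f - h without a calculus of one-sided derivatives. *)
Lemma has_derivative_within_growth (R : realType) (a b : R)
    (f f' h dh : R -> R) (x C : R) (k : nat) :
  0 <= C -> has_derivative_within `[a, b] f f' ->
  (forall s : R, is_derive s 1 h (dh s)) ->
  a <= x <= b ->
  (forall s, a <= s <= b -> `|f' s - dh s| <= C * `|s - x| ^+ k) ->
  forall t, a <= t <= b ->
  `|(f t - h t) - (f x - h x)| <= C * `|t - x| ^+ k.+1.
Proof.
move=> C0 df dh_ /andP[ax xb] bnd t /andP[at_ tb].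
have cfh : {within `[a, b], continuous (f - h)}.
  move=> y; apply: cvgB; first exact: has_derivative_within_continuous df y.
  have : {within `[a, b], continuous h}; last exact.
  apply: continuous_subspaceT => z.
  apply/differentiable_continuous/derivable1_diffP.
  exact: (@ex_derive _ _ _ _ _ _ _ (dh_ z)).
(* MVT between x and t, in whichever order they come *)
have mvt u v : a <= u -> u <= v -> v <= b -> exists2 c, u <= c <= v &
    (f v - h v) - (f u - h u) = (f' c - dh c) * (v - u).
  move=> au uv vb.
  have [||c cuv E] := @MVT_segment _ (f - h) (f' - dh) u v uv.
  - move=> y; rewrite in_itv/= => /andP[uy yv].
    have := @has_derivative_within_is_derive _ _ _ _ y df.
    rewrite interior_itv => H.
    have {}H : is_derive y 1 f (f' y).
      by apply: H; rewrite /= in_itv/= (le_lt_trans au uy) (lt_le_trans yv vb).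
    exact: is_deriveB.
  - apply: continuous_subspaceW cfh => y /=.
    rewrite !in_itv/= => /andP[uy yv].
    by rewrite (le_trans au uy) (le_trans yv vb).
  by exists c => //; rewrite in_itv in cuv.
suff [c cx ->] : exists2 c, a <= c <= b /\ `|c - x| <= `|t - x| &
    (f t - h t) - (f x - h x) = (f' c - dh c) * (t - x).
  case: cx => abc cx; rewrite normrM exprSr mulrA ler_wpM2r//.
  by rewrite (le_trans (bnd _ abc))// ler_wpM2l// lerXn2r ?nnegrE.
have [xt|/ltW tx] := leP x t.
  have [c /andP[xc ct] E] := mvt _ _ ax xt tb; exists c => //; split.
    by rewrite (le_trans ax xc) (le_trans ct tb).
  by rewrite !ger0_norm ?subr_ge0// lerD2r.
have [c /andP[tc cx] E] := mvt _ _ at_ tx xb; exists c.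
  split; first by rewrite (le_trans at_ tc) (le_trans cx xb).
  by rewrite !ler0_norm ?subr_le0// lerN2 lerD2r.
by rewrite -[LHS]opprB E -mulrN opprB.
Qed.

(** Induction on k: integrate the approximation of f' to get that of f.  At
    k = 0 the function is merely bounded, by compactness, so the top derivative
    enters only through its bound. *)
Lemma Ck_within_taylor (R : realType) (a b x : R) (k : nat) (f : R -> R) :
  Ck_within `[a, b] k f -> a <= x <= b ->
  exists (q : {poly R}) (C : R), [/\ (size q <= k)%N, 0 <= C &
    forall t, a <= t <= b -> `|f t - q.[t - x]| <= C * `|t - x| ^+ k].
Proof.
move=> + xab; elim: k f => [|k IH] f /=.
  move=> cf.
  have /compact_bounded[M [_ /(_ (M + 1))]] :=
    continuous_compact cf (@segment_compact R a b).
  rewrite ltrDl ltr01 => /(_ isT) M1.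
  exists 0, `|M + 1|; rewrite size_poly0; split=> // t tab.
  rewrite horner0 subr0 expr0 mulr1 (le_trans _ (ler_norm _))//.
  by apply: M1; exists t => //=; rewrite in_itv.
case=> f' df /IH[q [C [sq C0 qC]]].
(* the antiderivative of q whose value at 0 is f x *)
pose Q := \poly_(i < k.+1) (if i is j.+1 then q`_j / j.+1%:R else f x).
have dQ : Q^`() = q.
  apply/polyP => i; rewrite coef_deriv coef_poly ltnS.
  case: ltnP => [ik|/(leq_trans sq) ki]; last first.
    by rewrite mul0rn nth_default.
  by rewrite -[LHS]mulr_natr divfK.
exists Q, C; split=> //; first exact: size_poly.
have dh (s : R) : is_derive s 1 (horner (Q \Po ('X - x%:P))) q.[s - x].
  have := is_derive_poly (Q \Po ('X - x%:P)) s.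
  by rewrite deriv_comp dQ derivXsubC mulr1 horner_comp hornerXsubC.
move=> t tab.
have := has_derivative_within_growth C0 df dh xab _ tab.
have Qx : Q.[x - x] = f x by rewrite subrr horner_coef0 coef_poly.
rewrite !horner_comp !hornerXsubC Qx subrr subr0; apply=> s sab.
exact: qC.
Qed.

(** * Integrals of polynomials against the Bernstein basis *)

(* The degree and the index are often successors; unfolding would destroy the
   Bernstein polynomials in which the identities below are expressed. *)
Arguments bernstein : simpl never.

Definition bernstein_poly {R : realType} (n k : nat) : {poly R} :=
  'C(n, k)%:R * ('X^k * (1 - 'X) ^+ (n - k)).

Definition poly_int {R : realType} (p : {poly R}) : R :=
  \int[lebesgue_measure]_(t in `[0, 1]) p.[t].

(** The average of f for the Beta(k + 1, n - k + 1) distribution. *)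
Definition durrmeyer_coef {R : realType} (n k : nat) (f : R -> R) : R :=
  (n%:R + 1) *
  \int[lebesgue_measure]_(t in `[0, 1]) (bernstein n k%:Z t * f t).

Lemma horner_bernstein_poly (R : realType) (n k : nat) (t : R) :
  (bernstein_poly n k).[t] = bernstein n k%:Z t.
Proof. by rewrite /bernstein_poly -polyC_natr !hornerE. Qed.

Lemma continuous_within_horner (R : realType) (A : set R) (p : {poly R}) :
  {within A, continuous (horner p)}.
Proof. by apply: continuous_subspaceT; exact: continuous_horner. Qed.

Lemma continuous_within_bernsteinM (R : realType) (A : set R) (n k : nat)
    (f : R -> R) :
  {within A, continuous f} ->
  {within A, continuous (fun t => bernstein n k%:Z t * f t)}.
Proof.
move=> cf t; have -> : bernstein n k%:Z = horner (bernstein_poly n k) :> (R -> R).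
  by apply/funext => y; rewrite horner_bernstein_poly.
by apply: cvgM; [exact: continuous_within_horner|exact: cf].
Qed.

Lemma integrable01_continuous (R : realType) (f : R -> R) :
  {within `[0, 1], continuous f} ->
  (@lebesgue_measure R).-integrable `[0, 1] (EFin \o f).
Proof.
by move=> cf; apply: continuous_compact_integrable; first exact: segment_compact.
Qed.

Lemma poly_int_is_linear (R : realType) :
  linear_for *%R (@poly_int R : {poly R} -> R).
Proof.
move=> a p q; rewrite /poly_int -RintegralZl//; last first.
  exact/integrable01_continuous/continuous_within_horner.
rewrite -RintegralD//=.
- by apply: eq_Rintegral => t _; rewrite !hornerE.
- rewrite (_ : (fun x => _) = horner (a *: p)).
    exact/integrable01_continuous/continuous_within_horner.
  by apply/funext => t; rewrite hornerZ.
- exact/integrable01_continuous/continuous_within_horner.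
Qed.

HB.instance Definition _ (R : realType) :=
  GRing.isLinear.Build R {poly R} R *%R (@poly_int R) (@poly_int_is_linear R).

Lemma poly_int_deriv (R : realType) (p : {poly R}) :
  poly_int p^`() = p.[1] - p.[0].
Proof.
rewrite /poly_int /Rintegral (@continuous_FTC2 _ _ (horner p))//.
- exact: continuous_within_horner.
- split; first by move=> t _; exact: derivable_horner.
  + by apply: cvg_at_right_filter; exact: continuous_horner.
  + by apply: cvg_at_left_filter; exact: continuous_horner.
- by move=> t _; rewrite derivE.
Qed.

Lemma durrmeyer_coef_poly (R : realType) (n k : nat) (q : {poly R}) :
  durrmeyer_coef n k (horner q) = n.+1%:R * poly_int (bernstein_poly n k * q).
Proof.
rewrite /durrmeyer_coef natr1; congr (_ * _); apply: eq_Rintegral => t _.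
by rewrite hornerM horner_bernstein_poly.
Qed.

Lemma deriv_bernstein_poly (R : realType) (n k : nat) : (k <= n)%N ->
  (bernstein_poly n.+1 k.+1)^`() =
  n.+1%:R * (bernstein_poly n k - bernstein_poly n k.+1) :> {poly R}.
Proof.
move=> kn; rewrite /bernstein_poly subSS subnS.
have diag : n.+1%:R * 'C(n, k)%:R = k.+1%:R * 'C(n.+1, k.+1)%:R :> {poly R}.
  by rewrite -!natrM mul_bin_diag.
have down : n.+1%:R * 'C(n, k.+1)%:R = (n - k)%:R * 'C(n.+1, k.+1)%:R
    :> {poly R}.
  by rewrite -!natrM mul_bin_down subSS.
rewrite mulrBr (mulrA n.+1%:R 'C(n, k)%:R) diag.
rewrite (mulrA n.+1%:R 'C(n, k.+1)%:R) down.
rewrite -[X in X * (_ * _)]polyC_natr mul_polyC derivZ derivM derivXn deriv_exp.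
rewrite derivB derivC derivX sub0r -mul_polyC polyC_natr /=.
ring.
Qed.

(** Integrate the derivative of p_{n+1,k+1} q, which vanishes at 0 and 1. *)
Lemma durrmeyer_coef_diff (R : realType) (n k : nat) (q : {poly R}) :
  (k < n)%N ->
  durrmeyer_coef n k.+1 (horner q) - durrmeyer_coef n k (horner q) =
  durrmeyer_coef n.+1 k.+1 (horner q^`()) / n.+2%:R.
Proof.
move=> kn; rewrite !durrmeyer_coef_poly [in RHS]mulrAC divff ?pnatr_eq0// mul1r.
have := poly_int_deriv (bernstein_poly n.+1 k.+1 * q).
rewrite derivM deriv_bernstein_poly 1?ltnW//.
have b0 : (bernstein_poly n.+1 k.+1).[0] = 0 :> R.
  by rewrite horner_bernstein_poly /bernstein expr0n mulr0 mul0r.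
have b1 : (bernstein_poly n.+1 k.+1).[1] = 0 :> R.
  by rewrite horner_bernstein_poly /bernstein subrr expr0n subn_eq0 ltnNge kn mulr0.
rewrite 2!(hornerM (bernstein_poly _ _)) b0 b1 !mul0r subrr.
rewrite -mulrA -polyC_natr mul_polyC linearD linearZ /= mulrBl linearB /= => E.
apply/eqP; rewrite -subr_eq0 -oppr_eq0 -E; apply/eqP; ring.
Qed.

(** The averages of the constant 1 do not depend on k, because its derivative
    vanishes; for k = 0 the integral is elementary. *)
Lemma durrmeyer_coef1 (R : realType) (n k : nat) : (k <= n)%N ->
  durrmeyer_coef n k (horner (1 : {poly R})) = 1.
Proof.
elim: k => [_|k IH kn]; last first.
  have := durrmeyer_coef_diff (1 : {poly R}) kn; rewrite derivC IH 1?ltnW//.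
  by rewrite [X in _ = X / _]durrmeyer_coef_poly mulr0 linear0 mulr0 mul0r => /subr0_eq.
rewrite durrmeyer_coef_poly mulr1.
have := poly_int_deriv (- (1 - 'X) ^+ n.+1 : {poly R}).
rewrite derivN deriv_exp derivB derivC derivX !hornerE.
rewrite subrr subr0 expr1n expr0n /= oppr0 add0r opprK => int1.
transitivity (poly_int (n.+1%:R *: bernstein_poly n 0 : {poly R})).
  by rewrite linearZ.
rewrite -[RHS]int1; congr poly_int; rewrite /bernstein_poly bin0 expr0 subn0.
rewrite !mul1r -mul_polyC.
by rewrite polyC_natr; ring.
Qed.

(** The product t (1 - t) p_{n,k}(t) vanishes at 0 and 1, and its derivative is
    (k + 1 - (n + 2) t) p_{n,k}(t): this is the Pearson equation of the Beta
    distribution. *)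
Lemma durrmeyer_coef_by_parts (R : realType) (n k : nat) (q : {poly R}) :
  (k <= n)%N ->
  durrmeyer_coef n k (horner ('X * (1 - 'X) * q^`())) =
  durrmeyer_coef n k (horner ((n.+2%:R * 'X - k.+1%:R) * q)).
Proof.
move=> kn; rewrite !durrmeyer_coef_poly; congr (_ * _); apply/eqP.
rewrite -subr_eq0 -linearB /=; apply/eqP.
pose w : {poly R} := 'X^(k.+1) * (1 - 'X) ^+ (n - k).+1 * q.
have := poly_int_deriv ('C(n, k)%:R *: w).
rewrite /w !hornerE subrr !expr0n /= !(mulr0, mul0r) subrr => int0.
rewrite -[RHS]int0; congr poly_int.
rewrite derivZ !derivM !derivXn !deriv_exp derivB derivC derivX.
rewrite -mul_polyC polyC_natr.
rewrite /bernstein_poly.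
have -> : (n.+2%:R : {poly R}) = (n - k).+1%:R + k.+1%:R.
  by rewrite -natrD addSn addnS subnK.
rewrite /= !exprS; ring.
Qed.

(** * Sums over the binomial distribution *)

Lemma sum_bernstein (R : realType) (m : nat) (x : R) :
  \sum_(k < m.+1) bernstein m k%:Z x = 1.
Proof.
rewrite -[RHS](expr1n _ m) -[in RHS](subrK x 1) exprDn.
by apply: eq_bigr => k _; rewrite /bernstein /= -mulr_natl; ring.
Qed.

(** Stein's identity for the binomial distribution.  Since
    k - m x = k (1 - x) - (m - k) x, absorption of each factor into the
    binomial coefficient lowers the degree, with the index shifted in one of
    the two sums only. *)
Lemma sum_bernstein_centered (R : realType) (m : nat) (x : R) (g : nat -> R) :
  \sum_(k < m.+2) bernstein m.+1 k%:Z x * ((k%:R - m.+1%:R * x) * g k) =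
  m.+1%:R * x * (1 - x) *
  \sum_(k < m.+1) bernstein m k%:Z x * (g k.+1 - g k).
Proof.
have up (k : nat) : k.+1%:R * bernstein m.+1 k.+1%:Z x =
    m.+1%:R * x * bernstein m k%:Z x.
  rewrite /bernstein subSS !mulrA -natrM -mul_bin_diag natrM exprS; ring.
have down (k : nat) : (k <= m)%N ->
    (m.+1%:R - k%:R) * bernstein m.+1 k%:Z x =
    m.+1%:R * (1 - x) * bernstein m k%:Z x.
  move=> km; rewrite /bernstein -natrB 1?leqW// !mulrA -natrM.
  rewrite -mul_bin_down natrM subSn//= exprS; ring.
transitivity (\sum_(k < m.+2) (1 - x) * (k%:R * bernstein m.+1 k%:Z x * g k) -
   \sum_(k < m.+2) x * ((m.+1%:R - k%:R) * bernstein m.+1 k%:Z x * g k)).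
  by rewrite -sumrB; apply: eq_bigr => k _; ring.
rewrite big_ord_recl /= !mul0r mulr0 add0r.
rewrite [X in _ - X]big_ord_recr /= subrr !mul0r mulr0 addr0.
rewrite -sumrB mulr_sumr; apply: eq_bigr => k _.
rewrite /bump /= add1n up down -1?ltnS//; ring.
Qed.

(** * Shifted Bernstein-Durrmeyer operators *)

(** For i <= s and 0 <= x <= 1 this is the expectation of f(T), where K is binomial (m, x) and
    T given K is Beta(K + i + 1, m + s - K - i + 1).  The shifts s and i are
    kept as parameters because differentiation and the recurrence for the
    moments change them. *)
Definition durrmeyer_op {R : realType} (m s i : nat) (x : R) (f : R -> R) : R :=
  \sum_(k < m.+1) bernstein m k%:Z x * durrmeyer_coef (m + s) (k + i) f.

Definition durrmeyer_poly {R : realType} (m s i : nat) (x : R)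
    (q : {poly R}) : R :=
  durrmeyer_op m s i x (horner q).

Lemma durrmeyer_poly_is_linear (R : realType) (m s i : nat) (x : R) :
  linear_for *%R (durrmeyer_poly m s i x).
Proof.
move=> a p q; rewrite /durrmeyer_poly /durrmeyer_op mulr_sumr -big_split /=.
apply: eq_bigr => k _; rewrite !durrmeyer_coef_poly mulrDr -(scalerAr a _ p) linearP /=.
ring.
Qed.

HB.instance Definition _ (R : realType) (m s i : nat) (x : R) :=
  GRing.isLinear.Build R {poly R} R *%R (durrmeyer_poly m s i x)
    (@durrmeyer_poly_is_linear R m s i x).

Lemma durrmeyer_polyD (R : realType) (m s i : nat) (x : R) (p q : {poly R}) :
  durrmeyer_poly m s i x (p + q) =
  durrmeyer_poly m s i x p + durrmeyer_poly m s i x q.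
Proof. exact: linearD. Qed.

Lemma durrmeyer_polyB (R : realType) (m s i : nat) (x : R) (p q : {poly R}) :
  durrmeyer_poly m s i x (p - q) =
  durrmeyer_poly m s i x p - durrmeyer_poly m s i x q.
Proof. exact: linearB. Qed.

Lemma durrmeyer_polyZ (R : realType) (m s i : nat) (x a : R) (p : {poly R}) :
  durrmeyer_poly m s i x (a *: p) = a * durrmeyer_poly m s i x p.
Proof. exact: linearZ. Qed.

Lemma durrmeyer_poly1 (R : realType) (m s i : nat) (x : R) : (i <= s)%N ->
  durrmeyer_poly m s i x 1 = 1.
Proof.
move=> is_; rewrite -[RHS](sum_bernstein m x); apply: eq_bigr => k _.
by rewrite durrmeyer_coef1 ?mulr1// leq_add// -ltnS.
Qed.

(** This trades the factor m in the coefficients of the operator for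
    derivatives: every difference in i gains one factor 1/n. *)
Lemma durrmeyer_poly_diff (R : realType) (m s i : nat) (x : R) (q : {poly R}) :
  (i < s)%N ->
  durrmeyer_poly m s i.+1 x q - durrmeyer_poly m s i x q =
  durrmeyer_poly m s.+1 i.+1 x q^`() / (m + s).+2%:R.
Proof.
move=> is_; rewrite -sumrB mulr_suml; apply: eq_bigr => k _.
rewrite -mulrBr !addnS durrmeyer_coef_diff ?mulrA//.
by rewrite -addnS leq_add// -ltnS.
Qed.

(** Multiplication by t - x is resolved by splitting
    (n + 2)(t - x) = ((n + 2) t - (k + i + 1)) + (k + i + 1 - (n + 2) x):
    the first part is integrated by parts in t, and in the second k - m x is
    summed by parts in k.  For m = 0 the factor m annihilates the last
    term, so truncation of the predecessor is harmless. *)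
Lemma durrmeyer_poly_centeredM (R : realType) (m s i : nat) (x : R)
    (q : {poly R}) :
  (i <= s)%N ->
  (m + s).+2%:R * durrmeyer_poly m s i x (('X - x%:P) * q) =
  durrmeyer_poly m s i x ('X * (1 - 'X) * q^`()) +
  (i.+1%:R - s.+2%:R * x) * durrmeyer_poly m s i x q +
  m%:R * x * (1 - x) / (m + s).+2%:R * durrmeyer_poly m.-1 s.+2 i.+1 x q^`().
Proof.
move=> is_; set n := (m + s)%N.
have parts (k : nat) : (k <= m)%N ->
    n.+2%:R * durrmeyer_coef n (k + i) (horner (('X - x%:P) * q)) =
    durrmeyer_coef n (k + i) (horner ('X * (1 - 'X) * q^`())) +
    ((k + i).+1%:R - n.+2%:R * x) * durrmeyer_coef n (k + i) (horner q).
  move=> km; rewrite durrmeyer_coef_by_parts ?leq_add// !durrmeyer_coef_poly.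
  set b := bernstein_poly n (k + i).
  have -> : b * ((n.+2%:R * 'X - (k + i).+1%:R) * q) =
      n.+2%:R *: (b * (('X - x%:P) * q)) -
      ((k + i).+1%:R - n.+2%:R * x) *: (b * q).
    by rewrite -!mul_polyC rmorphB rmorphM /= !polyC_natr; ring.
  have lin (c : R) (p : {poly R}) : poly_int (c *: p) = c * poly_int p.
    by rewrite linearZ.
  by rewrite linearB /= !lin; ring.
have centered : \sum_(k < m.+1) bernstein m k%:Z x *
      ((k%:R - m%:R * x) * durrmeyer_coef n (k + i) (horner q)) =
    m%:R * x * (1 - x) / n.+2%:R * durrmeyer_poly m.-1 s.+2 i.+1 x q^`().
  rewrite /n; case: m @n {parts} => [|m].
    by rewrite big_ord1 /= !mul0r subrr mul0r mulr0.
  rewrite (sum_bernstein_centered m x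
    (fun k => durrmeyer_coef (m.+1 + s) (k + i) (horner q))).
  rewrite [RHS]mulrAC -[RHS]mulrA; congr (_ * _).
  rewrite mulr_suml; apply: eq_bigr => k _.
  rewrite -(mulrA (bernstein _ _ _)) !addnS !addSn durrmeyer_coef_diff//=.
  by rewrite ltnS leq_add// -ltnS.
rewrite -centered /durrmeyer_poly /durrmeyer_op !mulr_sumr -!big_split /=.
apply: eq_bigr => k _.
rewrite mulrCA parts ?[(k <= m)%N]leq_ord// -/n.
have -> : (k + i).+1%:R - n.+2%:R * x =
    (i.+1%:R - s.+2%:R * x) + (k%:R - m%:R * x) by rewrite /n; ring.
ring.
Qed.

(** The case q = (t - x)^j of the preceding identity, where t (1 - t) is
    expanded around x as x (1 - x) + (1 - 2x)(t - x) - (t - x)^2; the quadratic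
    term is moved to the left-hand side.  At j = 0 the factor j
    annihilates the terms with a truncated predecessor. *)
Lemma durrmeyer_poly_moment_rec (R : realType) (m s i j : nat) (x : R) :
  (i <= s)%N ->
  (m + s + j).+2%:R * durrmeyer_poly m s i x (('X - x%:P) ^+ j.+1) =
  (j%:R * (1 - 2 * x) + i.+1%:R - s.+2%:R * x) *
    durrmeyer_poly m s i x (('X - x%:P) ^+ j) +
  j%:R * x * (1 - x) * (durrmeyer_poly m s i x (('X - x%:P) ^+ j.-1) +
    m%:R / (m + s).+2%:R *
    durrmeyer_poly m.-1 s.+2 i.+1 x (('X - x%:P) ^+ j.-1)).
Proof.
move=> is_; have := durrmeyer_poly_centeredM m x (('X - x%:P) ^+ j) is_.
have dY : (('X - x%:P) ^+ j)^`() = j%:R *: ('X - x%:P) ^+ j.-1.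
  by rewrite deriv_exp derivXsubC mul1r scaler_nat.
rewrite -exprS dY durrmeyer_polyZ.
have -> : 'X * (1 - 'X) * (j%:R *: ('X - x%:P) ^+ j.-1) =
    (j%:R * x * (1 - x)) *: ('X - x%:P) ^+ j.-1 +
    ((j%:R * (1 - 2 * x)) *: ('X - x%:P) ^+ j - j%:R *: ('X - x%:P) ^+ j.+1).
  rewrite -!mul_polyC !rmorphM !rmorphB /= !rmorphM /= !rmorph1 !polyC_natr.
  by case: j {dY} => [|j] /=; rewrite ?exprS; ring.
rewrite durrmeyer_polyD durrmeyer_polyB !durrmeyer_polyZ => rec.
have -> : (m + s + j).+2%:R = (m + s).+2%:R + j%:R :> R by ring.
rewrite mulrDl rec; ring.
Qed.

Lemma durrmeyer_poly_moment1 (R : realType) (m s i : nat) (x : R) :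
  (i <= s)%N ->
  durrmeyer_poly m s i x (('X - x%:P) ^+ 1) =
  (i.+1%:R - s.+2%:R * x) / (m + s).+2%:R.
Proof.
move=> is_; have := durrmeyer_poly_moment_rec m 0 x is_.
rewrite !mul0r !addr0 add0r addn0 expr0 durrmeyer_poly1// mulr1 => <-.
by rewrite mulrAC divff ?mul1r ?pnatr_eq0.
Qed.

(** The recurrence divides by n and expresses the moment of order j + 2 by
    those of order j + 1 and j, so two orders cost one factor 1/n.  The
    statement is uniform in the shifts s and i since the recurrence raises
    them; it also needs two consecutive orders at a time. *)
Lemma durrmeyer_poly_moment_bound (R : realType) (s i j : nat) (x : R) :
  (i <= s)%N -> exists2 C : R, 0 <= C & forall m,
    `|durrmeyer_poly m s i x (('X - x%:P) ^+ j)| <= C / (m + s).+1%:R ^+ uphalf j.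
Proof.
suff : forall s i, (i <= s)%N ->
    (exists2 C : R, 0 <= C & forall m,
      `|durrmeyer_poly m s i x (('X - x%:P) ^+ j)| <=
        C / (m + s).+1%:R ^+ uphalf j) /\
    (exists2 C : R, 0 <= C & forall m,
      `|durrmeyer_poly m s i x (('X - x%:P) ^+ j.+1)| <=
        C / (m + s).+1%:R ^+ uphalf j.+1).
  by move=> H /H[].
elim: j => [|j IH] {}s {}i is_.
  split.
    by exists 1 => // m; rewrite expr0 durrmeyer_poly1// normr1 expr0 divr1.
  exists `|i.+1%:R - s.+2%:R * x| => // m; rewrite durrmeyer_poly_moment1//.
  rewrite normrM [X in _ * X]ger0_norm ?invr_ge0// expr1.
  by rewrite ler_wpM2l// lef_pV2 ?posrE ?ltr0n// ler_nat.
have [B1 B2] := IH s i is_; split=> //.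
have [[C0 C00 H0] [C1 C10 H1]] := (B1, B2).
have [|[C2 C20 H2] _] := IH s.+2 i.+1; first by rewrite ltnS ltnW.
set A := j.+1%:R * (1 - 2 * x) + i.+1%:R - s.+2%:R * x.
set B := j.+1%:R * x * (1 - x).
exists (`|A| * C1 + `|B| * (C0 + C2)).
  by rewrite addr_ge0 ?mulr_ge0 ?addr_ge0.
move=> m; have := durrmeyer_poly_moment_rec m j.+1 x is_; rewrite -/A -/B succnK => rec.
set N : R := (m + s).+1%:R; have N0 : 0 < N by rewrite ltr0n.
have pw k : 0 < N ^+ k by rewrite exprn_gt0.
rewrite (_ : uphalf j.+2 = (uphalf j).+1)// (exprSr _ (uphalf j)) invfM mulrA.
rewrite ler_pdivlMr// ler_pdivlMr//.
apply: (@le_trans _ _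
  (`|(m + s + j.+1).+2%:R * durrmeyer_poly m s i x (('X - x%:P) ^+ j.+2)| *
   N ^+ uphalf j)).
  rewrite (ler_wpM2r (ltW (pw _)))// normrM mulrC ler_wpM2r// ger0_norm//.
  rewrite ler_nat.
  by rewrite ltnW// ltnS ltnS leq_addr.
rewrite rec; apply: (@le_trans _ _ (`|A| * (C1 / N ^+ uphalf j) * N ^+ uphalf j +
  `|B| * ((C0 + C2) / N ^+ uphalf j) * N ^+ uphalf j)); last first.
  by rewrite -!mulrA !mulVf ?mulr1// gt_eqF.
rewrite -mulrDl (ler_wpM2r (ltW (pw _)))// (le_trans (ler_normD _ _))// !normrM lerD//.
  rewrite ler_wpM2l// (le_trans (H1 m))// -/N ler_wpM2l//.
  rewrite lef_pV2 ?posrE// ler_weXn2l ?ler1n//.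
  by rewrite uphalf_leq.
rewrite ler_wpM2l// (le_trans (ler_normD _ _))// mulrDl lerD//.
rewrite normrM ger0_norm ?divr_ge0//.
(* the term with m - 1 is absent when m = 0 *)
case: m {rec} @N N0 pw => [|m] N N0 pw.
  by rewrite !mul0r divr_ge0// ltW.
rewrite (le_trans (ler_piMl _ _))//.
  by rewrite ler_pdivrMr ?ltr0n// mul1r ler_nat leqW// leqW// leq_addr.
rewrite (le_trans (H2 m))// ler_wpM2l// lef_pV2 ?posrE ?exprn_gt0//.
by rewrite lerXn2r ?nnegrE// ler_nat !addnS addSn.
Qed.

(** * The operator of the theorem *)

(** Reindexing the three shifted Bernstein polynomials of degree n - 2. *)
Lemma DtildeE (R : realType) (m : nat) (x : R) (f : R -> R) :
  Dtilde m.+2 f x =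
  (m%:R * x ^+ 2 - m.+2%:R * x + 3 / 2) * durrmeyer_op m 2 0 x f +
  2 * m%:R * x * (1 - x) * durrmeyer_op m 2 1 x f +
  (m%:R * x ^+ 2 - (m%:R - 2) * x - 1 / 2) * durrmeyer_op m 2 2 x f.
Proof.
have shift (i : nat) (F : nat -> R) : (i < 3)%N ->
    \sum_(k < m.+3) bernstein m (k%:Z - i%:Z) x * F k =
    \sum_(k < m.+1) bernstein m k%:Z x * F (k + i)%N.
  move=> i3; rewrite -(big_mkord xpredT
    (fun k : nat => bernstein m (k%:Z - i%:Z) x * F k)).
  (* below i the index is negative, from m + 1 + i on the binomial vanishes *)
  rewrite (@big_cat_nat _ _ _ i)//=; last by rewrite ltnW// (leq_trans i3).
  rewrite big_nat big1 ?add0r => [|k /andP[_ ki]]; last first.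
    have -> : k%:Z - i%:Z = Negz (i - k).-1.
      by rewrite NegzE prednK ?subn_gt0// -subzn 1?ltnW// opprB.
    by rewrite mul0r.
  rewrite (@big_cat_nat _ _ _ (m.+1 + i))/=; last 2 first.
  - by rewrite leq_addl.
  - by rewrite -(addn2 m.+1) leq_add2l -ltnS.
  rewrite [X in _ + X]big_nat [X in _ + X]big1 ?addr0 => [|k /andP[mk _]].
    rewrite -{1}[i]add0n big_addn addnK big_mkord; apply: eq_bigr => k _.
    by rewrite PoszD addrK.
  rewrite -(subnK (leq_trans (leq_addl _ _) mk)) PoszD addrK.
  by rewrite /bernstein bin_small ?mul0r// ltn_subRL addnC.
rewrite /Dtilde /durrmeyer_op.
have int_shift i (F : nat -> R) : (i < 3)%N -> forall c,
    c * \sum_(k < m.+1) bernstein m k%:Z x * F (k + i)%N =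
    \sum_(k < m.+3) c * (bernstein m (k%:Z - i%:Z) x * F k).
  by move=> i3 c; rewrite -shift// mulr_sumr.
rewrite addn2 !(int_shift _ (durrmeyer_coef m.+2 ^~ f))// mulr_sumr -!big_split /=.
apply: eq_bigr => k _; rewrite /ptilde /durrmeyer_coef subSS subSS subn0 subr0.
have -> : m.+2%:R = m%:R + 2 :> R by ring.
ring.
Qed.

Lemma Dtilde_linear (R : realType) (m : nat) (x a : R) (p q : {poly R}) :
  Dtilde m.+2 (horner (a *: p + q)) x =
  a * Dtilde m.+2 (horner p) x + Dtilde m.+2 (horner q) x.
Proof.
rewrite !DtildeE -!/(durrmeyer_poly _ _ _ _ _).
rewrite !durrmeyer_polyD !durrmeyer_polyZ; ring.
Qed.

(** Up to terms that are bounded in m, the coefficients of [DtildeE] are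
    -m x (1 - x) times 1, -2, 1; the second difference becomes a second
    derivative. *)
Lemma Dtilde_poly_deriv2 (R : realType) (m : nat) (x : R) (q : {poly R}) :
  Dtilde m.+2 (horner q) x =
  (3 / 2 - 2 * x) * durrmeyer_poly m 2 0 x q +
  (2 * x - 1 / 2) * durrmeyer_poly m 2 2 x q -
  m%:R * x * (1 - x) / (m.+4%:R * m.+4.+1%:R) * durrmeyer_poly m 4 2 x q^`()^`().
Proof.
rewrite DtildeE -!/(durrmeyer_poly _ _ _ _ _).
have n4 : m.+4%:R != 0 :> R by rewrite pnatr_eq0.
have n5 : m.+4.+1%:R != 0 :> R by rewrite pnatr_eq0.
have d1 := durrmeyer_poly_diff m x q (isT : (0 < 2)%N).
have d2 := durrmeyer_poly_diff m x q (isT : (1 < 2)%N).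
have d3 := durrmeyer_poly_diff m x q^`() (isT : (1 < 3)%N).
have -> : durrmeyer_poly m 4 2 x q^`()^`() = m.+4.+1%:R * m.+4%:R *
    (durrmeyer_poly m 2 2 x q - durrmeyer_poly m 2 1 x q -
     (durrmeyer_poly m 2 1 x q - durrmeyer_poly m 2 0 x q)).
  rewrite d1 d2 -mulrBl d3 addn2 addn3.
  move: (m.+4%:R) (m.+4.+1%:R) n4 n5 => u v u0 v0.
  by field; rewrite u0 v0.
have -> : m.+2%:R = m%:R + 2 :> R by ring.
move: (m.+4%:R) (m.+4.+1%:R) n4 n5 => u v u0 v0.
by field; rewrite u0 v0.
Qed.

Lemma Dtilde_moment (R : realType) (m j : nat) (x : R) :
  Dtilde m.+2 (horner (('X - x%:P) ^+ j)) x =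
  (3 / 2 - 2 * x) * durrmeyer_poly m 2 0 x (('X - x%:P) ^+ j) +
  (2 * x - 1 / 2) * durrmeyer_poly m 2 2 x (('X - x%:P) ^+ j) -
  (j * j.-1)%:R * x * (1 - x) * (m%:R / (m.+4%:R * m.+4.+1%:R)) *
    durrmeyer_poly m 4 2 x (('X - x%:P) ^+ j.-2).
Proof.
rewrite Dtilde_poly_deriv2.
have -> : (('X - x%:P) ^+ j)^`()^`() =
    (j * j.-1)%:R *: ('X - x%:P) ^+ j.-2 :> {poly R}.
  rewrite deriv_exp derivXsubC mul1r derivMn deriv_exp derivXsubC mul1r.
  by rewrite -mulrnA mulnC scaler_nat.
rewrite durrmeyer_polyZ; ring.
Qed.

Lemma Dtilde_moment2 (R : realType) (m : nat) (x : R) :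
  Dtilde m.+2 (horner (('X - x%:P) ^+ 2)) x =
  (20 * x * (1 - x) - 3) / (m.+4%:R * m.+4.+1%:R).
Proof.
rewrite Dtilde_moment expr0 durrmeyer_poly1// (_ : (2 * 2.-1)%N = 2%N)//.
have n4 : m.+4%:R != 0 :> R by rewrite pnatr_eq0.
have n5 : m.+4.+1%:R != 0 :> R by rewrite pnatr_eq0.
have second i : (i <= 2)%N -> durrmeyer_poly m 2 i x (('X - x%:P) ^+ 2) =
    ((1 - 2 * x + i.+1%:R - 4 * x) * (i.+1%:R - 4 * x) / m.+4%:R +
     x * (1 - x) * (1 + m%:R / m.+4%:R)) / m.+4.+1%:R.
  move=> i2; have := durrmeyer_poly_moment_rec m 1 x i2.
  have i4 : (i < 4)%N by rewrite ltnS ltnW.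
  rewrite succnK expr0 !durrmeyer_poly1// durrmeyer_poly_moment1// addn2 addn1 => rec.
  apply: (mulfI n5); rewrite rec.
  move: (m.+4%:R) (m.+4.+1%:R) n4 n5 => u v u0 v0.
  by field; rewrite u0 v0.
rewrite !second//.
have -> : m%:R = m.+4%:R - 4 :> R by ring.
have {second} -> : m.+4.+1%:R = m.+4%:R + 1 :> R by ring.
have {}n5 : m.+4%:R + 1 != 0 :> R by rewrite natr1.
move: (m.+4%:R) n4 n5 => u u0 v0.
by field; rewrite u0 v0.
Qed.

(** The orders 0 and 1 are reproduced exactly and order 2 is explicit.  From
    order 3 on every term is small enough by itself: ceil(j/2) >= 2 in the
    first two, and in the third a factor m / n^2 multiplies a moment of order
    j - 2 >= 1. *)
Lemma Dtilde_moment_bound (R : realType) (x : R) (j : nat) :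
  exists2 C : R, 0 <= C & forall m,
    `|Dtilde m.+2 (horner (('X - x%:P) ^+ j)) x - (j == 0)%:R| <=
      C / m.+3%:R ^+ 2.
Proof.
case: j => [|[|[|j]]].
- exists 0 => // m; rewrite Dtilde_moment expr0 !durrmeyer_poly1// mul0n mulr0n !mul0r subr0.
  by rewrite (_ : _ - _ = 0) ?normr0//=; field.
- exists 0 => // m; rewrite Dtilde_moment muln0 mulr0n !mul0r !subr0.
  rewrite !durrmeyer_poly_moment1// addn2 [X in `|X|](_ : _ = 0) ?normr0//.
  have : m.+4%:R != 0 :> R by rewrite pnatr_eq0.
  by move: (m.+4%:R) => u u0; field.
- exists `|20 * x * (1 - x) - 3| => // m.
  rewrite subr0 Dtilde_moment2 normrM ler_wpM2l// ger0_norm ?invr_ge0//.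
  rewrite -natrM -natrX lef_pV2 ?posrE ?ltr0n ?expn_gt0// ler_nat.
  by rewrite -mulnn; apply: leq_mul; [exact: leqnSn|exact: (leq_addl 2)].
have [Ca Ca0 Ha] := @durrmeyer_poly_moment_bound R 2 0 j.+3 x isT.
have [Cb Cb0 Hb] := @durrmeyer_poly_moment_bound R 2 2 j.+3 x isT.
have [Cc Cc0 Hc] := @durrmeyer_poly_moment_bound R 4 2 j.+1 x isT.
exists (`|3 / 2 - 2 * x| * Ca + `|2 * x - 1 / 2| * Cb +
    `|(j.+3 * j.+2)%:R * x * (1 - x)| * Cc).
  by rewrite !addr_ge0 ?mulr_ge0.
move=> m; rewrite subr0 Dtilde_moment.
set N : R := m.+3%:R; have N0 : 0 < N by rewrite ltr0n.
have N1 : 1 <= N by rewrite ler1n.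
have drop C i (h : nat -> R) : 0 <= C ->
    (forall m, `|h m| <= C / (m + 2).+1%:R ^+ uphalf j.+3) ->
    `|i * h m| <= `|i| * C / N ^+ 2.
  move=> C0 H; rewrite normrM -mulrA ler_wpM2l// (le_trans (H m))// addn2.
  by rewrite ler_wpM2l// lef_pV2 ?posrE ?exprn_gt0// ler_weXn2l.
rewrite 2!(mulrDl _ _ (N ^+ 2)^-1) (le_trans (ler_normB _ _))// lerD//.
  rewrite (le_trans (ler_normD _ _))// lerD//.
    exact: (drop Ca _ (fun m => durrmeyer_poly m 2 0 x (('X - x%:P) ^+ j.+3)) Ca0 Ha).
  exact: (drop Cb _ (fun m => durrmeyer_poly m 2 2 x (('X - x%:P) ^+ j.+3)) Cb0 Hb).
rewrite -mulrA normrM -[X in _ <= X]mulrA ler_wpM2l//.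
have -> : Cc / N ^+ 2 = N^-1 * (Cc / N) by rewrite expr2 invfM mulrCA.
rewrite normrM; apply: ler_pM => //.
  rewrite ger0_norm ?divr_ge0 ?mulr_ge0// ler_pdivrMr ?mulr_gt0 ?ltr0n//.
  rewrite mulrC ler_pdivlMr// -!natrM ler_nat.
  by apply: leq_mul; [exact: (leq_addl 4)|exact: (leq_addl 2)].
rewrite (le_trans (Hc m))// ler_wpM2l// lef_pV2 ?posrE ?exprn_gt0//.
rewrite (@le_trans _ _ (m + 4).+1%:R)//.
  by rewrite ler_nat addn4 (leq_addl 2).
by rewrite -[X in X <= _]expr1 ler_weXn2l// ler1n.
Qed.

Lemma Dtilde_poly_bound (R : realType) (x : R) (q : {poly R}) :
  exists2 C : R, 0 <= C & forall m,
    `|Dtilde m.+2 (horner (q \Po ('X - x%:P))) x - q.[0]| <= C / m.+3%:R ^+ 2.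
Proof.
have /choice[C HC] : forall j, exists C : R, 0 <= C /\ forall m,
    `|Dtilde m.+2 (horner (('X - x%:P) ^+ j)) x - (j == 0)%:R| <=
      C / m.+3%:R ^+ 2.
  by move=> j; have [C C0 H] := Dtilde_moment_bound x j; exists C.
exists (\sum_(j < size q) `|q`_j| * C j).
  by apply: sumr_ge0 => j _; rewrite mulr_ge0//; case: (HC j).
move=> m.
have Dsum (r : seq 'I_(size q)) :
    Dtilde m.+2 (horner (\sum_(j <- r) q`_j *: ('X - x%:P) ^+ j)) x =
    \sum_(j <- r) q`_j * Dtilde m.+2 (horner (('X - x%:P) ^+ j)) x.
  elim: r => [|j r IH]; last by rewrite !big_cons Dtilde_linear IH.
  rewrite !big_nil; apply/eqP.
  by have /eqP := Dtilde_linear m x 1 0 0; rewrite scaler0 addr0 mul1r -subr_eq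
    subrr eq_sym.
have -> : q.[0] = \sum_(j < size q) q`_j * (j == 0 :> nat)%:R.
  rewrite horner_coef; apply: eq_bigr => j _.
  by rewrite expr0n.
rewrite comp_polyE Dsum -sumrB mulr_suml (le_trans (ler_norm_sum _ _ _))//.
apply: ler_sum => j _; rewrite -mulrBr normrM -mulrA ler_wpM2l//.
by case: (HC j).
Qed.

(** * The remainder term *)

Lemma bernstein_ge0 (R : realType) (n k : nat) (x : R) : 0 <= x <= 1 ->
  0 <= bernstein n k%:Z x.
Proof.
by move=> /andP[x0 x1]; rewrite /bernstein !mulr_ge0// exprn_ge0// subr_ge0.
Qed.

Lemma durrmeyer_coefD (R : realType) (n k : nat) (f g : R -> R) :
  {within `[0, 1], continuous f} -> {within `[0, 1], continuous g} ->
  durrmeyer_coef n k (f \+ g) = durrmeyer_coef n k f + durrmeyer_coef n k g.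
Proof.
move=> cf cg; rewrite /durrmeyer_coef -mulrDr -RintegralD//; first last.
- exact/integrable01_continuous/continuous_within_bernsteinM.
- exact/integrable01_continuous/continuous_within_bernsteinM.
by congr (_ * _); apply: eq_Rintegral => t _; rewrite mulrDr.
Qed.

Lemma le_durrmeyer_coef (R : realType) (n k : nat) (f g : R -> R) :
  {within `[0, 1], continuous f} -> {within `[0, 1], continuous g} ->
  (forall t, 0 <= t <= 1 -> `|f t| <= g t) ->
  `|durrmeyer_coef n k f| <= durrmeyer_coef n k g.
Proof.
move=> cf cg fg; rewrite /durrmeyer_coef normrM ger0_norm ?addr_ge0//.
rewrite ler_wpM2l ?addr_ge0//.
have If := integrable01_continuous (@continuous_within_bernsteinM _ _ n k _ cf).
rewrite (le_trans (le_normr_Rintegral _ If))// le_Rintegral//.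
- exact: integrable_norm.
- exact/integrable01_continuous/continuous_within_bernsteinM.
- move=> t; rewrite /= in_itv /= => t01.
  by rewrite normrM ger0_norm ?bernstein_ge0// ler_wpM2l ?bernstein_ge0// fg.
Qed.

Lemma durrmeyer_opD (R : realType) (m s i : nat) (x : R) (f g : R -> R) :
  {within `[0, 1], continuous f} -> {within `[0, 1], continuous g} ->
  durrmeyer_op m s i x (f \+ g) =
  durrmeyer_op m s i x f + durrmeyer_op m s i x g.
Proof.
move=> cf cg; rewrite -big_split; apply: eq_bigr => k _.
by rewrite durrmeyer_coefD// mulrDr.
Qed.

Lemma le_durrmeyer_op (R : realType) (m s i : nat) (x : R) (f g : R -> R) :
  0 <= x <= 1 ->
  {within `[0, 1], continuous f} -> {within `[0, 1], continuous g} ->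
  (forall t, 0 <= t <= 1 -> `|f t| <= g t) ->
  `|durrmeyer_op m s i x f| <= durrmeyer_op m s i x g.
Proof.
move=> x01 cf cg fg; rewrite (le_trans (ler_norm_sum _ _ _))//.
apply: ler_sum => k _; rewrite normrM ger0_norm ?bernstein_ge0//.
by rewrite ler_wpM2l ?bernstein_ge0// le_durrmeyer_coef.
Qed.

(** The coefficients of [DtildeE] are at most 4 n' in absolute value and sixth
    moments are O(n'^-3), with n' = m + 3. *)
Lemma Dtilde_remainder_bound (R : realType) (x C : R) (g : R -> R) :
  0 <= x <= 1 -> 0 <= C -> {within `[0, 1], continuous g} ->
  (forall t, 0 <= t <= 1 -> `|g t| <= C * `|t - x| ^+ 6) ->
  exists2 K : R, 0 <= K & forall m, `|Dtilde m.+2 g x| <= K / m.+3%:R ^+ 2.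
Proof.
move=> x01 C0 cg gC.
have [K0 K00 H0] := @durrmeyer_poly_moment_bound R 2 0 6 x isT.
have [K1 K10 H1] := @durrmeyer_poly_moment_bound R 2 1 6 x isT.
have [K2 K20 H2] := @durrmeyer_poly_moment_bound R 2 2 6 x isT.
exists (4 * C * K0 + 4 * C * K1 + 4 * C * K2).
  by rewrite !addr_ge0 ?mulr_ge0.
move=> m; set N : R := m.+3%:R; have N0 : 0 < N by rewrite ltr0n.
have dom a i K : `|a| <= 4 * N ->
    (forall m, `|durrmeyer_poly m 2 i x (('X - x%:P) ^+ 6)| <=
      K / (m + 2).+1%:R ^+ uphalf 6) ->
    `|a * durrmeyer_op m 2 i x g| <= 4 * C * K / N ^+ 2.
  move=> aN HK; rewrite normrM.
  have -> : 4 * C * K / N ^+ 2 = 4 * N * (C * (K / N ^+ 3)).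
    by field; rewrite gt_eqF.
  apply: ler_pM => //.
  apply: (@le_trans _ _ (C * durrmeyer_poly m 2 i x (('X - x%:P) ^+ 6))).
    rewrite -durrmeyer_polyZ; apply: le_durrmeyer_op => //.
      exact: continuous_within_horner.
    move=> t /gC; rewrite hornerZ horner_exp hornerXsubC.
    by rewrite -normrX [`|_ ^+ 6|]ger0_norm// exprn_even_ge0.
  by rewrite ler_wpM2l// (le_trans (ler_norm _))// (le_trans (HK m))// addn2.
have [x0 x1] := andP x01.
(* the only part of the coefficients that is unbounded in m is m x (1 - x) *)
have P0 : 0 <= x * (1 - x) by rewrite mulr_ge0// subr_ge0.
have mP : m%:R * (x * (1 - x)) <= m%:R.
  by rewrite ler_piMr// mulr_ile1// ?subr_ge0// gerBl.
have mP0 : 0 <= m%:R * (x * (1 - x)) by rewrite mulr_ge0.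
have Nm : N = m%:R + 3 by rewrite /N; ring.
have m0 : 0 <= m%:R :> R by [].
rewrite DtildeE (le_trans (ler_normD _ _))//.
rewrite 2!(mulrDl _ _ (N ^+ 2)^-1) lerD//; last first.
  apply: dom => //; rewrite (_ : _ - _ - _ =
    2 * x - 1 / 2 - m%:R * (x * (1 - x))); last by field.
  by rewrite ler_norml Nm; apply/andP; split; lra.
rewrite (le_trans (ler_normD _ _))// lerD//; apply: dom => //.
  rewrite (_ : _ - _ + _ = 3 / 2 - 2 * x - m%:R * (x * (1 - x))).
    by rewrite ler_norml Nm; apply/andP; split; lra.
  by rewrite -[m.+2]addn2 natrD; field.
rewrite (_ : 2 * _ * _ * _ = 2 * (m%:R * (x * (1 - x)))); last by ring.
by rewrite ler_norml Nm; apply/andP; split; lra.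
Qed.

(** * Order of approximation *)

Unset Implicit Arguments.
Set Strict Implicit.

Theorem theorem3p1 (R : realType) (f : R -> R) (x : R)
    (hf : Ck_within `[0, 1] 6 f) (hx : 0 <= x <= 1) :
  (fun n : nat => Dtilde n f x - f x) =O_\oo (fun n : nat => n%:R ^- 2 : R).
Proof.
have [q [C [_ C0 qC]]] := Ck_within_taylor hf hx.
pose p := q \Po ('X - x%:P); pose g t := f t - p.[t].
have px t : p.[t] = q.[t - x] by rewrite horner_comp hornerXsubC.
have fx : f x = q.[0].
  by apply/eqP; have := qC x hx; rewrite subrr normr0 expr0n mulr0 normr_le0
    subr_eq0.
have cf : {within `[0, 1], continuous f}.
  by case: hf => f' /has_derivative_within_continuous.
have cp : {within `[0, 1], continuous (horner p)}.
  exact: continuous_within_horner.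
have cg : {within `[0, 1], continuous g}.
  by move=> t; apply: cvgB; [exact: cf|exact: cp].
have [K K0 HK] : exists2 K : R, 0 <= K &
    forall m, `|Dtilde m.+2 g x| <= K / m.+3%:R ^+ 2.
  by apply: (Dtilde_remainder_bound hx C0 cg) => t /qC; rewrite /g px.
have [L L0 HL] := Dtilde_poly_bound x q.
have split m : Dtilde m.+2 f x - f x =
    (Dtilde m.+2 (horner p) x - q.[0]) + Dtilde m.+2 g x.
  have fE : f = horner p \+ g by apply/funext => t; rewrite /g /= addrC subrK.
  rewrite -fx {1}fE !DtildeE !(durrmeyer_opD _ _ _ _ cp cg); ring.
apply/eqO_exP; exists (L + K + 1); first by rewrite ltr_wpDl ?addr_ge0.
exists 2%N => // -[|[|m]]//= _.
rewrite split (le_trans (ler_normD _ _))// (le_trans (lerD (HL m) (HK m)))//.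
rewrite -mulrDl ger0_norm ?invr_ge0 ?exprn_ge0//.
apply: ler_pM; rewrite ?addr_ge0 ?invr_ge0 ?exprn_ge0//.
  by rewrite lerDl.
by rewrite lef_pV2 ?posrE ?exprn_gt0 ?ltr0n// lerXn2r ?nnegrE// ler_nat.
Qed.
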